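(* Let $d\ge 1$ be an integer and let $\mathbb K=\mathbb R$ or $\mathbb K=\mathbb C$. For every $\xi=(\xi^i_j)_{i,j=1}^d\in\mathfrak{gl}_d(\mathbb K)$, all elements $f,g$ of the center $\mathcal Z(U\mathfrak{gl}_d)$ of the universal enveloping algebra $U\mathfrak{gl}_d$, and all natural numbers $p,q$, the elements $\hat\partial_\xi^{\,p}f$ and $\hat\partial_\xi^{\,q}g$ commute in $U\mathfrak{gl}_d$, i.e. $[\hat\partial_\xi^{\,p}f,\hat\partial_\xi^{\,q}g]=0$, where $\hat\partial_\xi=\sum_{i,j=1}^d\xi^i_j\,\hat\partial^j_i$ is the directional quasi-derivation.
   Context: The Lie algebra $\mathfrak{gl}_d$ over $\mathbb K$ has basis $e^i_j$, $i,j=1,\dots,d$, with bracket $[e^i_j,e^p_q]=\delta^p_j e^i_q-e^p_j\delta^i_q$ (where $\delta$ is the Kronecker delta). $U\mathfrak{gl}_d$ is the unital associative $\mathbb K$-algebra generated by the $e^i_j$ subject to the relations $e^i_je^p_q-e^p_qe^i_j=\delta^p_je^i_q-e^p_j\delta^i_q$. The partial quasi-derivations are the $\mathbb K$-linear operators $\hat\partial^i_j:U\mathfrak{gl}_d\to U\mathfrak{gl}_d$, $i,j=1,\dots,d$, which are well defined and uniquely determined by the conditions: (1) $\hat\partial^i_j(1)=0$; (2) $\hat\partial^i_j(e^p_q)=\delta^p_j\delta^i_q$; (3) $\hat\partial^i_j(fg)=(\hat\partial^i_jf)\,g+f\,(\hat\partial^i_jg)+\sum_{k=1}^d(\hat\partial^k_jf)(\hat\partial^i_kg)$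 for all $f,g\in U\mathfrak{gl}_d$. $\hat\partial_\xi^{\,p}$ denotes the $p$-fold iterate of $\hat\partial_\xi$. *)

(* Defs.v *)
From HB Require Import structures.
From mathcomp Require Import all_boot all_order all_algebra.
From mathcomp Require Import generic_quotient.
From mathcomp Require Import boolp reals complex.

Set Implicit Arguments.
Unset Strict Implicit.
Unset Printing Implicit Defensive.

Import GRing.Theory.
Local Open Scope ring_scope.
Local Open Scope quotient_scope.

(* U gl_d is built from its presentation: formal noncommutative expressions   *)
(* in the generators, modulo the smallest congruence containing the axioms of *)
(* unital associative K-algebras and the commutation relations. UGen i j is   *)
(* e^i_j, with upper index i and lower index j.                               *)
Inductive ugl_expr (K : fieldType) (d : nat) : Type :=
| UGen of 'I_d & 'I_d
| UCst of K
| UAdd of ugl_expr K d & ugl_expr K d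
| UMul of ugl_expr K d & ugl_expr K d.

Arguments UGen {K d}.
Arguments UCst {K d}.

Definition USub (K : fieldType) (d : nat) (x y : ugl_expr K d) :=
  UAdd x (UMul (UCst (-1)) y).

HB.instance Definition _ K d := gen_eqMixin (ugl_expr K d).
HB.instance Definition _ K d := gen_choiceMixin (ugl_expr K d).

Inductive ugl_rel (K : fieldType) (d : nat) : ugl_expr K d -> ugl_expr K d -> Prop :=
| ugl_rel_refl x : ugl_rel x x
| ugl_rel_sym x y : ugl_rel x y -> ugl_rel y x
| ugl_rel_trans y x z : ugl_rel x y -> ugl_rel y z -> ugl_rel x z
| ugl_rel_add x x' y y' :
    ugl_rel x x' -> ugl_rel y y' -> ugl_rel (UAdd x y) (UAdd x' y')
| ugl_rel_mul x x' y y' :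
    ugl_rel x x' -> ugl_rel y y' -> ugl_rel (UMul x y) (UMul x' y')
| ugl_rel_cstD a b : ugl_rel (UCst (a + b)) (UAdd (UCst a) (UCst b))
| ugl_rel_cstM a b : ugl_rel (UCst (a * b)) (UMul (UCst a) (UCst b))
| ugl_rel_cstC a x : ugl_rel (UMul (UCst a) x) (UMul x (UCst a))
| ugl_rel_addA x y z : ugl_rel (UAdd x (UAdd y z)) (UAdd (UAdd x y) z)
| ugl_rel_addC x y : ugl_rel (UAdd x y) (UAdd y x)
| ugl_rel_add0 x : ugl_rel (UAdd (UCst 0) x) x
| ugl_rel_mulA x y z : ugl_rel (UMul x (UMul y z)) (UMul (UMul x y) z)
| ugl_rel_mul1 x : ugl_rel (UMul (UCst 1) x) x
| ugl_rel_mul0 x : ugl_rel (UMul (UCst 0) x) (UCst 0)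
| ugl_rel_mulDl x y z :
    ugl_rel (UMul (UAdd x y) z) (UAdd (UMul x z) (UMul y z))
| ugl_rel_mulDr x y z :
    ugl_rel (UMul x (UAdd y z)) (UAdd (UMul x y) (UMul x z))
| ugl_rel_gl i j p q :
    ugl_rel (USub (UMul (UGen i j) (UGen p q)) (UMul (UGen p q) (UGen i j)))
            (USub (UMul (UCst (p == j)%:R) (UGen i q))
                  (UMul (UCst (i == q)%:R) (UGen p j))).

Section Eval.
Variables (K : fieldType) (d : nat).
Variables (B : nzRingType) (s : {rmorphism K -> B}) (b : 'I_d -> 'I_d -> B).

Fixpoint ugl_eval (x : ugl_expr K d) : B :=
  match x with
  | UGen i j => b i j
  | UCst c => s c
  | UAdd x y => ugl_eval x + ugl_eval y
  | UMul x y => ugl_eval x * ugl_eval y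
  end.

Hypothesis sb : forall c i j, GRing.comm (s c) (b i j).
Hypothesis b_rel : forall i j p q, b i j * b p q - b p q * b i j =
  s (p == j)%:R * b i q - s (i == q)%:R * b p j.

Lemma ugl_eval_rel x y : ugl_rel x y -> ugl_eval x = ugl_eval y.
Proof.
have eval_cstC c z : GRing.comm (s c) (ugl_eval z).
  elim: z => /= [i j|a|y1 h1 y2 h2|y1 h1 y2 h2]; first exact: sb.
  - by rewrite /GRing.comm -!rmorphM mulrC.
  - exact: commrD.
  - exact: commrM.
elim=> {x y} //=.
- by move=> y x z _ -> _ ->.
- by move=> x x' y y' _ -> _ ->.
- by move=> x x' y y' _ -> _ ->.
- by move=> a c; rewrite rmorphD.
- by move=> a c; rewrite rmorphM.
- by move=> *; rewrite addrA.
- by move=> *; rewrite addrC.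
- by move=> *; rewrite rmorph0 add0r.
- by move=> *; rewrite mulrA.
- by move=> *; rewrite rmorph1 mul1r.
- by move=> *; rewrite rmorph0 mul0r.
- by move=> *; rewrite mulrDl.
- by move=> *; rewrite mulrDr.
- by move=> i j p q; rewrite !rmorphN1 !mulN1r b_rel.
Qed.

End Eval.

Section Ugl.
Variables (K : fieldType) (d : nat).
Implicit Types (x y z : ugl_expr K d) (c : K).

Definition ugl_relb x y : bool := `[< ugl_rel x y >].

Lemma ugl_relb_equiv : equiv_class_of ugl_relb.
Proof.
split=> [x|x y|y x z]; first exact/asboolP/ugl_rel_refl.
  by apply/asboolP/asboolP; apply: ugl_rel_sym.
by move=> /asboolP xy /asboolP yz; apply/asboolP/(ugl_rel_trans xy yz).
Qed.

Canonical ugl_relb_equivRel := EquivRelPack ugl_relb_equiv.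

Definition ugl := {eq_quot ugl_relb}.

HB.instance Definition _ := Choice.on ugl.
HB.instance Definition _ := EqQuotient.on ugl.

Definition ugl_pi x : ugl := \pi_ugl x.

Lemma ugl_piP x y : ugl_pi x = ugl_pi y <-> ugl_rel x y.
Proof. by split=> [/eqmodP/asboolP|h] //; apply/eqmodP/asboolP. Qed.

Lemma ugl_piK u : ugl_pi (repr u) = u.
Proof. exact: reprK. Qed.

Lemma ugl_pi_ind (P : ugl -> Prop) : (forall x, P (ugl_pi x)) -> forall u, P u.
Proof. by move=> h u; rewrite -(ugl_piK u). Qed.

Definition ugl_add (u v : ugl) := ugl_pi (UAdd (repr u) (repr v)).
Definition ugl_mul (u v : ugl) := ugl_pi (UMul (repr u) (repr v)).
Definition ugl_cst c := ugl_pi (UCst c).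
Definition ugl_opp (u : ugl) := ugl_mul (ugl_cst (-1)) u.
Definition ugl_scale c (u : ugl) := ugl_mul (ugl_cst c) u.

Lemma ugl_piD x y : ugl_add (ugl_pi x) (ugl_pi y) = ugl_pi (UAdd x y).
Proof. by apply/ugl_piP; apply: ugl_rel_add; apply/ugl_piP/ugl_piK. Qed.

Lemma ugl_piM x y : ugl_mul (ugl_pi x) (ugl_pi y) = ugl_pi (UMul x y).
Proof. by apply/ugl_piP; apply: ugl_rel_mul; apply/ugl_piP/ugl_piK. Qed.

Lemma ugl_cstD a b : ugl_cst (a + b) = ugl_add (ugl_cst a) (ugl_cst b).
Proof. by rewrite ugl_piD; apply/ugl_piP/ugl_rel_cstD. Qed.

Lemma ugl_cstM a b : ugl_cst (a * b) = ugl_mul (ugl_cst a) (ugl_cst b).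
Proof. by rewrite ugl_piM; apply/ugl_piP/ugl_rel_cstM. Qed.

Lemma ugl_cstC c u : ugl_mul (ugl_cst c) u = ugl_mul u (ugl_cst c).
Proof. by elim/ugl_pi_ind: u => x; rewrite !ugl_piM; apply/ugl_piP/ugl_rel_cstC. Qed.

Lemma ugl_addA : associative ugl_add.
Proof.
elim/ugl_pi_ind=> x; elim/ugl_pi_ind=> y; elim/ugl_pi_ind=> z.
by rewrite !ugl_piD; apply/ugl_piP/ugl_rel_addA.
Qed.

Lemma ugl_addC : commutative ugl_add.
Proof.
elim/ugl_pi_ind=> x; elim/ugl_pi_ind=> y.
by rewrite !ugl_piD; apply/ugl_piP/ugl_rel_addC.
Qed.

Lemma ugl_add0 : left_id (ugl_cst 0) ugl_add.
Proof. by elim/ugl_pi_ind=> x; rewrite ugl_piD; apply/ugl_piP/ugl_rel_add0. Qed.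

Lemma ugl_mulA : associative ugl_mul.
Proof.
elim/ugl_pi_ind=> x; elim/ugl_pi_ind=> y; elim/ugl_pi_ind=> z.
by rewrite !ugl_piM; apply/ugl_piP/ugl_rel_mulA.
Qed.

Lemma ugl_mul1l : left_id (ugl_cst 1) ugl_mul.
Proof. by elim/ugl_pi_ind=> x; rewrite ugl_piM; apply/ugl_piP/ugl_rel_mul1. Qed.

Lemma ugl_mul1r : right_id (ugl_cst 1) ugl_mul.
Proof. by move=> u; rewrite -ugl_cstC ugl_mul1l. Qed.

Lemma ugl_mul0l u : ugl_mul (ugl_cst 0) u = ugl_cst 0.
Proof. by elim/ugl_pi_ind: u => x; rewrite ugl_piM; apply/ugl_piP/ugl_rel_mul0. Qed.

Lemma ugl_mulDl : left_distributive ugl_mul ugl_add.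
Proof.
elim/ugl_pi_ind=> x; elim/ugl_pi_ind=> y; elim/ugl_pi_ind=> z.
by rewrite !(ugl_piD, ugl_piM); apply/ugl_piP/ugl_rel_mulDl.
Qed.

Lemma ugl_mulDr : right_distributive ugl_mul ugl_add.
Proof.
elim/ugl_pi_ind=> x; elim/ugl_pi_ind=> y; elim/ugl_pi_ind=> z.
by rewrite !(ugl_piD, ugl_piM); apply/ugl_piP/ugl_rel_mulDr.
Qed.

Lemma ugl_addN : left_inverse (ugl_cst 0) ugl_opp ugl_add.
Proof.
by move=> u; rewrite -{2}(ugl_mul1l u) -ugl_mulDl -ugl_cstD addNr ugl_mul0l.
Qed.

Lemma ugl_1neq0 : ugl_cst 1 != ugl_cst 0.
Proof.
apply/eqP => /ugl_piP /(@ugl_eval_rel K d K idfun (fun _ _ => 0)) /=.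
move=> h; have /eqP := oner_neq0 K; apply; apply: h => [*|i j p q].
  exact: mulrC.
by rewrite !mulr0.
Qed.

HB.instance Definition _ := GRing.isZmodule.Build ugl ugl_addA ugl_addC ugl_add0 ugl_addN.

HB.instance Definition _ := GRing.Zmodule_isNzRing.Build ugl
  ugl_mulA ugl_mul1l ugl_mul1r ugl_mulDl ugl_mulDr ugl_1neq0.

Lemma ugl_scaleA a b u : ugl_scale a (ugl_scale b u) = ugl_scale (a * b) u.
Proof. by rewrite /ugl_scale ugl_cstM ugl_mulA. Qed.

Lemma ugl_scaleDl u : {morph ugl_scale^~ u : a b / a + b}.
Proof. by move=> a b; rewrite /ugl_scale ugl_cstD ugl_mulDl. Qed.

HB.instance Definition _ := GRing.Zmodule_isLmodule.Build K ugl
  ugl_scaleA ugl_mul1l (fun c => ugl_mulDr (ugl_cst c)) ugl_scaleDl.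

Lemma ugl_scaleAl c (u v : ugl) : c *: (u * v) = c *: u * v.
Proof. exact: ugl_mulA. Qed.

HB.instance Definition _ := GRing.Lmodule_isLalgebra.Build K ugl ugl_scaleAl.

Lemma ugl_scaleAr c (u v : ugl) : c *: (u * v) = u * (c *: v).
Proof.
have E w : c *: w = w * ugl_cst c by exact: ugl_cstC.
by rewrite !E mulrA.
Qed.

HB.instance Definition _ := GRing.Lalgebra_isAlgebra.Build K ugl ugl_scaleAr.

Definition ugl_gen (i j : 'I_d) : ugl := ugl_pi (UGen i j).

Lemma ugl_genP i j p q :
  ugl_gen i j * ugl_gen p q - ugl_gen p q * ugl_gen i j =
  (p == j)%:R *: ugl_gen i q - (i == q)%:R *: ugl_gen p j.
Proof.
have /ugl_piP := @ugl_rel_gl K d i j p q.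
by rewrite -!ugl_piD -!ugl_piM.
Qed.

Lemma ugl_ind (P : ugl -> Prop) :
  P 1 -> (forall i j, P (ugl_gen i j)) ->
  (forall u v, P u -> P v -> P (u + v)) -> (forall c u, P u -> P (c *: u)) ->
  (forall u v, P u -> P v -> P (u * v)) -> forall u, P u.
Proof.
move=> P1 Pg PD PZ PM; elim/ugl_pi_ind=> x.
elim: x => [//|c|x Px y Py|x Px y Py].
- by rewrite -[X in P X]mulr1; apply: (PZ c).
- by rewrite -ugl_piD; apply: PD.
- by rewrite -ugl_piM; apply: PM.
Qed.

Lemma ugl_lift (B : nzRingType) (s : {rmorphism K -> B}) (b : 'I_d -> 'I_d -> B) :
  (forall c i j, GRing.comm (s c) (b i j)) ->
  (forall i j p q, b i j * b p q - b p q * b i j =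
     s (p == j)%:R * b i q - s (i == q)%:R * b p j) ->
  exists phi : {rmorphism ugl -> B},
    (forall i j, phi (ugl_gen i j) = b i j) /\
    (forall c u, phi (c *: u) = s c * phi u).
Proof.
move=> sb b_rel; pose phi (u : ugl) : B := ugl_eval s b (repr u).
have phi_pi x : phi (ugl_pi x) = ugl_eval s b x.
  by apply: (ugl_eval_rel sb b_rel); apply/ugl_piP/ugl_piK.
have phi_cst c : phi (ugl_cst c) = s c by rewrite phi_pi.
have phiD u v : phi (u + v) = phi u + phi v by rewrite [LHS]phi_pi.
have phiM u v : phi (u * v) = phi u * phi v by rewrite [LHS]phi_pi.
have phiZ c u : phi (c *: u) = s c * phi u by rewrite [LHS]phiM phi_cst.
have phiB : zmod_morphism phi.
  by move=> u v; rewrite phiD -scaleN1r phiZ rmorphN1 mulN1r.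
have phi1 : monoid_morphism phi.
  by split=> [|u v]; [rewrite [LHS]phi_cst rmorph1 | exact: phiM].
pose Phi : {rmorphism ugl -> B} := HB.pack phi
  (GRing.isZmodMorphism.Build ugl B phi phiB)
  (GRing.isMonoidMorphism.Build ugl B phi phi1).
by exists Phi; split=> [i j|c u] /=; [rewrite phi_pi | exact: phiZ].
Qed.

(* D i j is the operator with upper index i and lower index j.                *)
Record partial_quasi_derivations (D : 'I_d -> 'I_d -> {linear ugl -> ugl}) : Prop := {
  pqd1 : forall i j, D i j 1 = 0;
  pqd_gen : forall i j p q, D i j (ugl_gen p q) = (p == j)%:R * (i == q)%:R;
  pqdM : forall i j f g, D i j (f * g) =
    D i j f * g + f * D i j g + \sum_(k < d) D k j f * D i k g
}.

Lemma partial_quasi_derivations_unique D D' :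
  partial_quasi_derivations D -> partial_quasi_derivations D' ->
  forall i j f, D i j f = D' i j f.
Proof.
move=> hD hD' i j f.
elim/ugl_ind: f i j => [|p q|u v hu hv|c u hu|u v hu hv] i j.
- by rewrite !pqd1.
- by rewrite !pqd_gen.
- by rewrite !linearD /= hu hv.
- by rewrite !linearZ /= hu.
- rewrite !pqdM // hu hv; congr (_ + _).
  by apply: eq_bigr => k _; rewrite hu hv.
Qed.

(* xi i j is the coefficient with upper index i and lower index j.            *)
Definition directional_quasi_derivation (D : 'I_d -> 'I_d -> {linear ugl -> ugl})
    (xi : 'M[K]_d) (f : ugl) : ugl :=
  \sum_(i < d) \sum_(j < d) xi i j *: D j i f.

Definition ugl_center (f : ugl) : Prop := forall g : ugl, GRing.comm f g.

End Ugl.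

Arguments ugl_gen {K d}.

(* The matrix with row-j column-i entry f *+ (i == j) + D i j f is            *)
(* multiplicative in f; it extends e^p_q |-> e^p_q %:M + delta_mx p q.        *)
Lemma partial_quasi_derivations_exist (K : fieldType) (d : nat) : (0 < d)%N ->
  exists D : 'I_d -> 'I_d -> {linear ugl K d -> ugl K d},
    partial_quasi_derivations D.
Proof.
case: d => // d _; set U := ugl K d.+1.
pose s : {rmorphism K -> 'M[U]_d.+1} := @scalar_mx U d.+1 \o in_alg U.
pose b (p q : 'I_d.+1) : 'M[U]_d.+1 := (ugl_gen p q)%:M + delta_mx p q.
have scal_delta (u : U) p q : GRing.comm u%:M (delta_mx p q : 'M[U]_d.+1).
  rewrite /GRing.comm -!mulmxE mul_scalar_mx; apply/matrixP => i j.
  rewrite !mxE (bigD1 j) //= big1 => [|k kj]; rewrite !mxE.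
    by rewrite eqxx mulr1n addr0; case: (_ && _); rewrite ?mulr1 ?mul1r ?mulr0 ?mul0r.
  by rewrite (negPf kj) mulr0n mulr0.
have smM (x y : U) : x%:M * y%:M = (x * y)%:M :> 'M[U]_d.+1.
  exact/esym/scalar_mxM.
have sM c x : s c * x%:M = (c *: x)%:M by rewrite smM -scalerAl mul1r.
have sE c M i j : (s c * M) i j = c *: M i j.
  by rewrite -[s c * M]/(_ *m M) mul_scalar_mx mxE -scalerAl mul1r.
have sb c i j : GRing.comm (s c) (b i j).
  apply: commrD; last exact: scal_delta.
  by rewrite /GRing.comm sM smM -scalerAr mulr1.
have [|phi [phi_gen phiZ]] := ugl_lift sb.
  move=> i j p q; rewrite /b !mulrDl !mulrDr !sM !smM.
  rewrite (scal_delta (ugl_gen i j)) (scal_delta (ugl_gen p q)).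
  have ac (a c u v w z : 'M[U]_d.+1) :
      (a + u) + (v + w) - ((c + v) + (u + z)) = (a - c) + (w - z).
    have -> : a + u + (v + w) = u + v + (a + w) by rewrite [a + u]addrC addrACA.
    have -> : c + v + (u + z) = u + v + (c + z).
      by rewrite [c + v]addrC addrACA [v + u]addrC.
    by rewrite opprD addrACA subrr add0r opprD addrACA.
  rewrite ac -raddfB /= ugl_genP.
  have dE i' j' p' q' : delta_mx i' j' * delta_mx p' q' =
      delta_mx i' q' *+ (j' == p') :> 'M[U]_d.+1 by exact: mul_delta_mx_cond.
  have sD (n : bool) M : s n%:R * M = M *+ n by rewrite rmorph_nat mulr_natl.
  rewrite !dE !sD raddfB /= opprD [RHS]addrACA.
  by rewrite (eq_sym q) (eq_sym j).
pose D i j (u : U) : U := phi u j i - (i == j)%:R * u.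
have phiE u i j : phi u j i = D i j u + (i == j)%:R * u by rewrite subrK.
have D_lin i j : linear (D i j).
  move=> c u v; rewrite /D rmorphD phiZ mxE sE mulrDr -scalerAr opprD addrACA.
  by rewrite scalerBr.
pose L i j : {linear U -> U} :=
  HB.pack (D i j) (GRing.isLinear.Build K U U _ (D i j) (D_lin i j)).
exists L; split=> [i j|i j p q|i j f g] /=.
- by rewrite /D rmorph1 mxE mulr1 eq_sym subrr.
- rewrite /D phi_gen !mxE mulr_natl (eq_sym j i) addrAC subrr add0r.
  by rewrite (eq_sym j p) -natrM mulnb.
have phiM : phi (f * g) j i =
    \sum_k (D k j f + (k == j)%:R * f) * (D i k g + (i == k)%:R * g).
  by rewrite rmorphM [LHS]mxE; apply: eq_bigr => k _; rewrite -!phiE.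
have pick (F : 'I_d.+1 -> U) l : \sum_k (k == l)%:R * F k = F l.
  rewrite (bigD1 l) //= eqxx mul1r big1 ?addr0 // => k kl.
  by rewrite (negPf kl) mul0r.
have key (F G : 'I_d.+1 -> U) :
    \sum_k (F k + (k == j)%:R * f) * (G k + (i == k)%:R * g) =
    F i * g + f * G j + \sum_k F k * G k + (i == j)%:R * (f * g).
  have natC (n : bool) (u v : U) : u * (n%:R * v) = n%:R * (u * v).
    by rewrite !mulr_natl mulrnAr.
  under eq_bigr => k _ do
    rewrite mulrDl !mulrDr -!mulrA [F k * (_ * _)]natC (natC _ f) eq_sym.
  rewrite !big_split /= !pick [X in X + _]addrC addrA eq_sym; congr (_ + _).
  by rewrite addrAC.
by rewrite {1}/D phiM key addrK.
Qed.

(* Main.v *)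
From HB Require Import structures.
Require Import Defs.
From mathcomp Require Import all_boot all_order all_algebra.
From mathcomp Require Import reals complex.

Set Implicit Arguments.
Unset Strict Implicit.

Import GRing.Theory.
Local Open Scope ring_scope.

(** For u in U = U gl_d let phi(u) ([shift]) be the matrix over U with entries
    u delta_ab + (quasi-derivative of u in the direction (a, b)).  The Leibniz
    rule says exactly that phi is a ring morphism from U to the matrices over
    U: it is the coproduct followed by the vector representation in the second
    factor.  Let Omega be the matrix whose (a, b) entry is the generator with
    indices (b, a).  It is the mixed part of the coproduct of the Casimir
    element, hence commutes with every phi(u) ([OmegaC]).  Let X be the
    transpose of xi and write d for the directional quasi-derivation along xi.
    Commuting a generator past d gives [Omega, d u] = d [Omega, u] +
    [X, phi(u)] ([ad_dq]), so that [Omega, d^m f] = m [X, phi(d^(m-1) f)] when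
    f is central ([ad_iter_dq]).

    Fix f and g central and put c(xi) = [d^m f, d^n g], a polynomial map in xi,
    with gradient w(xi).  Two identities hold.  First, [Omega, c] = [X, w],
    which is equivariance of c under simultaneous conjugation
    ([ad_comm_family]).  Second, expanding [Omega, w] with the rules above,
    everything collapses to a multiple of the bracket of X with
    [phi(d^(m-1) f), phi(d^(n-1) g)] = phi([d^(m-1) f, d^(n-1) g]), which is
    zero by induction on m + n: thus w commutes with Omega
    ([gradient_comm], [comm_gradient_Omega]).  Moreover the transposition
    antiautomorphism theta of U fixes f and g, whence
    theta(c(xi)) = - c(transpose of xi) ([theta_comm_family]).

    A family c with these three properties is zero ([family0]).  This is
    Gelfand's trick applied to symbols.  Let c(x, xi) be the top degree part
    of c, a polynomial in a matrix x and in xi.  Since w commutes with Omega,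
    its symbol commutes with x; at a diagonal x it is diagonal, so c(x, xi)
    depends on the diagonal part of xi only.  Transposition fixes both x and
    this diagonal part, so c(x, xi) = - c(x, xi) = 0.  Equivariance then moves
    this vanishing from diagonal x to all x, so that the degree of c drops, and
    one repeats.  Symbols are read off without a PBW basis: n-fold
    quasi-derivatives of an element killed by all (n + 1)-fold ones are scalars
    ([order_lt1_cst]), and they are the polarized values of its symbol.  The
    same vanishing statement, applied to the constant family theta(f) - f, shows
    that theta fixes the center ([theta_center]). *)

(** * Sums over the deletions of one entry of a list *)

Section Deletion.
Variables (T : eqType) (V : nmodType).
Implicit Types (F : T -> seq T -> V) (v : seq T).

(** The shape of the Leibniz rule: [F] receives the deleted entry and the
    remaining list. *)
Fixpoint delsum F v : V :=
  if v is x :: v' then F x v' + delsum (fun y l => F y (x :: l)) v' else 0.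

Lemma eq_delsum F G v :
  (forall x l, perm_eq (x :: l) v -> F x l = G x l) -> delsum F v = delsum G v.
Proof.
elim: v F G => //= x v IHv F G eqFG; congr (_ + _); first exact: eqFG.
apply: IHv => y l ylv; apply: eqFG.
by rewrite (perm_catCA [:: y] [:: x]) /= perm_cons.
Qed.

Lemma delsum0 F v :
  (forall x l, perm_eq (x :: l) v -> F x l = 0) -> delsum F v = 0.
Proof.
move=> F0; rewrite (eq_delsum F0); elim: v {F0} => //= x v ->.
exact: addr0.
Qed.

Lemma delsum_sum (I : finType) (F : I -> T -> seq T -> V) v :
  delsum (fun x l => \sum_i F i x l) v = \sum_i delsum (F i) v.
Proof.
elim: v F => [|x v IHv] F /=; first by rewrite big1.
by rewrite IHv big_split.
Qed.

Lemma delsum_cat F v1 v2 :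
  delsum F (v1 ++ v2) =
  delsum (fun x l => F x (l ++ v2)) v1 + delsum (fun x l => F x (v1 ++ l)) v2.
Proof.
elim: v1 F => [|x v1 IHv] F /=; first by rewrite add0r.
by rewrite IHv addrA.
Qed.

Lemma delsum_nseq F n x : delsum F (nseq n.+1 x) = F x (nseq n x) *+ n.+1.
Proof.
elim: n F => [|n IHn] F; first exact: addr0.
rewrite -[LHS]/(_ + delsum (fun y l => F y (x :: l)) (nseq n.+1 x)).
by rewrite IHn [RHS]mulrS.
Qed.

End Deletion.

Lemma delsum_map (S T : eqType) (V : nmodType) (h : S -> T)
    (F : T -> seq T -> V) (v : seq S) :
  delsum F (map h v) = delsum (fun x l => F (h x) (map h l)) v.
Proof. by elim: v F => //= x v IHv F; rewrite IHv. Qed.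

Lemma delsumB (T : eqType) (V : zmodType) (F G : T -> seq T -> V) v :
  delsum (fun x l => F x l - G x l) v = delsum F v - delsum G v.
Proof.
elim: v F G => [|x v IHv] F G /=; first by rewrite subr0.
by rewrite IHv opprD addrACA.
Qed.

Section Char0.
Variables (K : fieldType) (V : lmodType K).
Hypothesis char0 : forall n, n.+1%:R != 0 :> K.

Lemma mulrSn_eq0 (u : V) n : u *+ n.+1 = 0 -> u = 0.
Proof.
rewrite -scaler_nat => /eqP; rewrite scaler_eq0 (negPf (char0 n)) /=.
by move/eqP.
Qed.

(** Read [tau] as the polarization of a polynomial on diagonal matrices: the
    hypothesis says that its product with the linear form x_a - x_b is zero, so
    the polynomial is zero.  Concretely the relation on a list with one more
    copy of [a] determines [tau], by induction on the number of other
    entries. *)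
Lemma delsum_inj (I : eqType) (a b : I) (tau : seq I -> V) n : a != b ->
  (forall l, size l = n.+1 ->
     delsum (fun i l => tau l *+ (i == a) - tau l *+ (i == b)) l = 0) ->
  forall l, size l = n -> tau l = 0.
Proof.
move=> ab tau_rel.
suff tau0 m l j : size l = m -> (m + j)%N = n -> tau (l ++ nseq j a) = 0.
  by move=> l szl; have := tau0 n l 0 szl (addn0 n); rewrite cats0.
elim: m l j => [|m IHm] l j szl mj.
all: have := tau_rel (l ++ nseq j.+1 a).
all: rewrite size_cat size_nseq szl addnS mj => /(_ erefl).
all: rewrite delsum_cat delsum_nseq eqxx (negPf ab) subr0 delsum0 ?add0r.
1,3: exact: mulrSn_eq0.
- by move=> x l' /perm_size; rewrite szl.
move=> x l' /perm_size; rewrite szl => -[szl'].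
by rewrite (IHm l' j.+1) ?mul0rn ?subrr // addnS -mj.
Qed.

End Char0.

(** * Polynomial families in an algebra *)

Section PolynomialFamilies.
Variables (K : fieldType) (A : algType K).
Hypothesis char0 : forall n, n.+1%:R != 0 :> K.

(** Substituting 2 t for t and subtracting 2 ^ n times the original relation
    removes the top coefficient. *)
Lemma powers_free n (u : nat -> A) :
  (forall t : K, \sum_(i < n) t ^+ i *: u i = 0) ->
  forall i, (i < n)%N -> u i = 0.
Proof.
elim: n u => // n IHn u u0.
have lt_u i : (i < n)%N -> u i = 0.
  move=> lt_in; suff : (2%:R ^+ i - 2%:R ^+ n) *: u i = 0.
    move/eqP; rewrite scaler_eq0 => /orP[|/eqP//].
    rewrite -(subnK (ltnW lt_in)) exprD -{1}[_ ^+ i]mul1r -mulrBl mulf_eq0.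
    rewrite expf_eq0 (negPf (char0 1)) andbF orbF.
    have -> : 1 - 2%:R ^+ (n - i) = - ((2 ^ (n - i)).-1)%:R :> K.
      by rewrite -natrX -[in LHS](prednK (expn_gt0 2 _)) mulrS opprD addNKr.
    rewrite oppr_eq0; case E : (2 ^ (n - i)).-1 => [|m].
      have := ltn_expl (n - i) (isT : 1 < 2)%N.
      by rewrite -(prednK (expn_gt0 2 _)) E ltnS leqn0 subn_eq0 leqNgt lt_in.
    by rewrite (negPf (char0 m)).
  apply: (IHn (fun i => (2%:R ^+ i - 2%:R ^+ n) *: u i)) => // t.
  transitivity (\sum_(i < n.+1) (2%:R * t) ^+ i *: u i
                - 2%:R ^+ n *: \sum_(i < n.+1) t ^+ i *: u i).
    rewrite scaler_sumr -sumrB big_ord_recr /= !exprMn scalerA subrr addr0.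
    apply: eq_bigr => j _; rewrite exprMn !scalerA -scalerBl mulrBr.
    by rewrite [t ^+ j * _]mulrC [t ^+ j * _]mulrC.
  by rewrite !u0 scaler0 subrr.
move=> i; rewrite ltnS leq_eqVlt => /orP[/eqP->|/lt_u//].
have := u0 1; rewrite big_ord_recr /= big1 => [|j _].
  by rewrite add0r expr1n scale1r.
by rewrite lt_u ?scaler0.
Qed.

Lemma horner_scalar n (P : {poly A}) (t : K) : (size P <= n)%N ->
  P.[t%:A] = \sum_(i < n) t ^+ i *: P`_i.
Proof.
move=> szP; rewrite (horner_coef_wide _ szP); apply: eq_bigr => i _.
by rewrite exprZn expr1n mulr_algr.
Qed.

Lemma horner_scalar0 (P : {poly A}) :
  (forall t : K, P.[t%:A] = 0) -> P = 0.
Proof.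
move=> P0; apply/polyP => i; rewrite coef0.
have [/(nth_default 0)//|] := leqP (size P) i.
apply: (@powers_free _ (fun i => P`_i)) => t.
by rewrite -(horner_scalar _ (leqnn _)).
Qed.

Lemma horner_map_linear (h : {linear A -> A}) (P : {poly A}) (t : K) :
  (map_poly h P).[t%:A] = h P.[t%:A].
Proof.
rewrite (@horner_scalar (size P)) ?size_poly //.
rewrite (horner_scalar _ (leqnn _)) linear_sum; apply: eq_bigr => i _.
by rewrite linearZ /= coef_map_id0 // raddf0.
Qed.

Lemma deriv_map_linear (h : {linear A -> A}) (P : {poly A}) :
  (map_poly h P)^`() = map_poly h P^`().
Proof.
apply/polyP => i.
by rewrite coef_deriv !coef_map_id0 ?raddf0 // coef_deriv raddfMn.
Qed.

Lemma family_deriv0 (h : {linear A -> A}) (P : {poly A}) :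
  (forall t : K, h P.[t%:A] = 0) -> forall t : K, h P^`().[t%:A] = 0.
Proof.
move=> hP t; have hP0 : map_poly h P = 0.
  by apply: horner_scalar0 => x; rewrite horner_map_linear.
by rewrite -horner_map_linear -deriv_map_linear hP0 deriv0 horner0.
Qed.

Lemma family_const (h : {linear A -> A}) (P : {poly A}) :
  (forall t : K, h P^`().[t%:A] = 0) ->
  forall s t : K, h P.[s%:A] = h P.[t%:A].
Proof.
move=> hP s t; have hP0 : (map_poly h P)^`() = 0.
  rewrite deriv_map_linear; apply: horner_scalar0 => x.
  by rewrite horner_map_linear.
suff [a Pa] : exists a, map_poly h P = a%:P.
  by rewrite -!horner_map_linear Pa !hornerC.
exists (map_poly h P)`_0; apply/polyP => -[|i]; rewrite coefC //=.
have := congr1 (fun p : {poly A} => p`_i) hP0; rewrite coef_deriv coef0.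
exact: mulrSn_eq0.
Qed.

End PolynomialFamilies.

(** * The commutator identity behind the induction *)

(** [W] is Omega, [F] and [G] are the images of two elements under phi, [f] and
    [g] scalar matrices, and [w] is the gradient of their commutator.  Since the
    commutator with [W] is a derivation, what is left is the sum [jacobi] below,
    which is the bracket of [X] with that of [F] and [G]. *)
Lemma gradient_comm (R : pzRingType) (W F G f g X : R) m n :
  W * F = F * W -> W * G = G * W -> F * G = G * F ->
  W * f - f * W = (X * F - F * X) *+ m ->
  W * g - g * W = (X * G - G * X) *+ n ->
  let w := (F * g - g * F) *+ m + (f * G - G * f) *+ n in W * w = w * W.
Proof.
set a := X * F - F * X; set b := X * G - G * X.
move=> WF WG FG Wf Wg w.
have {}Wf : W * f = f * W + a *+ m by rewrite -Wf addrC subrK.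
have {}Wg : W * g = g * W + b *+ n by rewrite -Wg addrC subrK.
have WFg : W * (F * g) = F * g * W + (F * b) *+ n.
  by rewrite mulrA WF -mulrA Wg mulrDr mulrA mulrnAr.
have WgF : W * (g * F) = g * F * W + (b * F) *+ n.
  by rewrite mulrA Wg mulrDl -(mulrA g) WF mulrA mulrnAl.
have WfG : W * (f * G) = f * G * W + (a * G) *+ m.
  by rewrite mulrA Wf mulrDl -(mulrA f) WG mulrA mulrnAl.
have WGf : W * (G * f) = G * f * W + (G * a) *+ m.
  by rewrite mulrA WG -mulrA Wf mulrDr mulrA mulrnAr.
have jacobi : F * b - b * F + (a * G - G * a) = 0.
  rewrite /a /b !(mulrBl, mulrBr) !mulrA.
  have -> : X * F * G = X * G * F by rewrite -!mulrA FG.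
  rewrite -FG; set t1 := F * X * G; set t2 := F * G * X.
  set t3 := X * G * F; set t4 := G * X * F.
  rewrite -[X in _ + X]opprK; apply/eqP; rewrite subr_eq0; apply/eqP.
  by rewrite !opprB addrACA [RHS]addrACA; congr (_ + _); rewrite addrC.
rewrite mulrDr mulrDl !mulrnAr !mulrnAl !mulrBr !mulrBl WFg WgF WfG WGf.
rewrite !opprD !(addrACA _ _ (- _)) -!mulrnBl !mulrnDl addrACA.
by rewrite -!mulrnA [(m * n)%N]mulnC -!mulrnDl jacobi mul0rn addr0.
Qed.

(** * The coproduct matrix and its commutation rules *)

Lemma sum_mulrb (V : nmodType) (I : finType) (F : I -> V) a :
  \sum_i F i *+ (i == a) = F a.
Proof.
by rewrite (bigD1 a) //= eqxx big1 ?addr0 // => i /negPf ->.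
Qed.

Lemma sum_mulrb_sym (V : nmodType) (I : finType) (F : I -> V) a :
  \sum_i F i *+ (a == i) = F a.
Proof. by under eq_bigr do rewrite eq_sym; exact: sum_mulrb. Qed.

Section QuasiDerivations.
Variables (K : fieldType) (d : nat).
Local Notation U := (ugl K d).
Local Notation e := (@ugl_gen K d).
Variable D : 'I_d -> 'I_d -> {linear U -> U}.
Hypothesis hD : partial_quasi_derivations D.

(** A pair [(a, b)] stands for a direction; the order of the indices makes
    [shift] below a morphism for the usual matrix product. *)
Definition qd (x : 'I_d * 'I_d) : {linear U -> U} := D x.2 x.1.

(** The coproduct of [u], with the vector representation applied to its second
    factor. *)
Definition shift (u : U) : 'M[U]_d :=
  \matrix_(a, b) (qd (a, b) u + u *+ (a == b)).

Lemma shift_zmod_morphism : zmod_morphism shift.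
Proof.
move=> u v; apply/matrixP => a b; rewrite !mxE linearB mulrnBl /=.
by rewrite opprD addrACA.
Qed.

HB.instance Definition _ :=
  GRing.isZmodMorphism.Build U 'M[U]_d shift shift_zmod_morphism.

Lemma shiftE u a b : shift u a b = qd (a, b) u + u *+ (a == b).
Proof. by rewrite mxE. Qed.

Lemma qdE u a b : qd (a, b) u = shift u a b - u *+ (a == b).
Proof. by rewrite shiftE addrK. Qed.

Lemma shift1 : shift 1 = 1%:M.
Proof. by apply/matrixP => a b; rewrite !mxE /qd (pqd1 hD) add0r. Qed.

Lemma shift_cst (c : K) : shift c%:A = c%:A%:M.
Proof.
by apply/matrixP => a b; rewrite !mxE linearZ /= /qd (pqd1 hD) scaler0 add0r.
Qed.

Lemma shift_gen p q : shift (e p q) = (e p q)%:M + delta_mx p q.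
Proof.
apply/matrixP => a b; rewrite !mxE /qd (pqd_gen hD) addrC; congr (_ + _).
by rewrite -natrM mulnb /= (eq_sym p) .
Qed.

Lemma shiftM u v : shift (u * v) = shift u *m shift v.
Proof.
apply/matrixP => a b; rewrite !mxE /qd (pqdM hD) /=.
under [RHS]eq_bigr => k _ do
  rewrite !shiftE mulrDr !mulrDl !mulrnAl !mulrnAr.
rewrite !big_split /= (sum_mulrb_sym (fun k => u * qd (k, b) v)).
rewrite (sum_mulrb (fun k => qd (a, k) u * v)).
rewrite (sum_mulrb_sym (fun k => u * v *+ (k == b))) /qd /=.
rewrite [RHS]addrA; congr (_ + _).
by rewrite [RHS]addrAC [LHS]addrC addrA.
Qed.

Lemma shiftMij u v a b : shift (u * v) a b = \sum_k shift u a k * shift v k b.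
Proof. by rewrite shiftM mxE. Qed.

Lemma shiftZij c u a b : shift (c *: u) a b = c *: shift u a b.
Proof. by rewrite !shiftE linearZ /= scalerDr scalerMnr. Qed.

Lemma shiftDij u v a b : shift (u + v) a b = shift u a b + shift v a b.
Proof. by rewrite raddfD mxE. Qed.

Lemma shiftBij u v a b : shift (u - v) a b = shift u a b - shift v a b.
Proof. by rewrite -[v in LHS]scale1r -scaleNr shiftDij shiftZij scaleN1r. Qed.

Lemma shiftMnij u n a b : shift (u *+ n) a b = shift u a b *+ n.
Proof. by rewrite -scaler_nat shiftZij scaler_nat. Qed.

Lemma shift1ij a b : shift 1 a b = (a == b)%:R.
Proof. by rewrite shift1 mxE. Qed.

Lemma shift_genij p q a b :
  shift (e p q) a b = e p q *+ (a == b) + ((a == p) && (b == q))%:R.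
Proof. by rewrite shift_gen !mxE. Qed.

(** Cocommutativity of the coproduct. *)
Lemma shiftC u a b x y :
  shift (shift u a b) x y = shift (shift u x y) a b.
Proof.
elim/ugl_ind: u a b x y => [|p q|u v IHu IHv|c u IHu|u v IHu IHv] a b x y.
- by rewrite !shift1ij !shiftMnij !shift1ij -!mulrnA mulnC.
- rewrite !shift_genij !shiftDij !shiftMnij !shift_genij !shift1ij !mulrnDl.
  rewrite -!mulrnA -!addrA mulnC; congr (_ + _).
  by rewrite [RHS]addrC; congr (_%:R + _%:R); apply: mulnC.
- by rewrite !shiftDij IHu IHv.
- by rewrite !shiftZij IHu.
- rewrite !shiftMij !raddf_sum /= !summxE.
  under eq_bigr do rewrite shiftMij.
  under [RHS]eq_bigr do rewrite shiftMij.
  rewrite exchange_big; apply: eq_bigr => i _; apply: eq_bigr => j _.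
  by rewrite IHu IHv.
Qed.

Lemma qdC x y u : qd x (qd y u) = qd y (qd x u).
Proof.
case: x y => [a b] [a' b'].
have E v a1 b1 a2 b2 : qd (a1, b1) (qd (a2, b2) v) =
    shift (shift v a2 b2) a1 b1 - shift v a1 b1 *+ (a2 == b2)
    - shift v a2 b2 *+ (a1 == b1) + v *+ (a2 == b2) *+ (a1 == b1).
  by rewrite !qdE shiftBij shiftMnij mulrnBl opprB !addrA addrAC.
rewrite !E shiftC -!mulrnA mulnC; congr (_ + _).
by rewrite -!addrA; congr (_ + _); rewrite addrC.
Qed.

Lemma qd_gen x p q : qd x (e p q) = ((x.1 == p) && (x.2 == q))%:R.
Proof. by rewrite /qd (pqd_gen hD) -natrM mulnb andbC (eq_sym p) andbC. Qed.

Lemma qdM x u v : qd x (u * v) =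
  qd x u * v + u * qd x v + \sum_k qd (x.1, k) u * qd (k, x.2) v.
Proof. exact: (pqdM hD). Qed.

Lemma qd_genM x p q u : qd x (e p q * u) =
  u *+ ((x.1 == p) && (x.2 == q)) + e p q * qd x u
  + qd (q, x.2) u *+ (x.1 == p).
Proof.
rewrite qdM qd_gen mulr_natl; congr (_ + _).
under eq_bigr do rewrite qd_gen /= mulr_natl -mulnb mulrnA.
by rewrite (sum_mulrb (fun k => qd (k, x.2) u *+ (x.1 == p))).
Qed.

Definition ad (w u : U) : U := w * u - u * w.

Lemma ad_is_linear w : linear (ad w).
Proof.
move=> c u v; rewrite /ad mulrDr mulrDl -scalerAr -scalerAl opprD addrACA.
by rewrite scalerBr.
Qed.
HB.instance Definition _ w :=
  GRing.isLinear.Build K U U _ (ad w) (ad_is_linear w).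

Lemma shift_ad p q u a b : shift (ad (e p q) u) a b =
  ad (e p q) (shift u a b)
  + (shift u q b *+ (a == p) - shift u a p *+ (b == q)).
Proof.
rewrite shiftBij !shiftMij.
under eq_bigr do
  rewrite shift_genij mulrDl mulr_natl mulrnAl -mulnb mulrnA.
under [X in _ - X]eq_bigr do
  rewrite shift_genij mulrDr mulr_natr mulrnAr -mulnb mulrnA mulrnAC.
rewrite !big_split /= (sum_mulrb_sym (fun i => e p q * shift u i b)).
rewrite (sum_mulrb (fun i => shift u i b *+ (a == p))).
rewrite (sum_mulrb (fun i => shift u a i * e p q)).
rewrite (sum_mulrb (fun i => shift u a i *+ (b == q))).
by rewrite /ad opprD addrACA.
Qed.

Lemma qd_ad p q x u : qd x (ad (e p q) u) =
  ad (e p q) (qd x u)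
  + (qd (q, x.2) u *+ (x.1 == p) - qd (x.1, p) u *+ (x.2 == q)).
Proof.
case: x => a b /=; rewrite !qdE shift_ad raddfB raddfMn /= addrAC.
congr (_ + _); first by rewrite [X in _ = _ - X]raddfMn.
rewrite !mulrnBl (eq_sym q) [u *+ (b == q) *+ _]mulrnAC.
by rewrite opprB addrA subrK ?mulNrn.
Qed.

Lemma comm_cst c (u : U) : c%:A * u = u * c%:A.
Proof. by rewrite mulr_algl mulr_algr. Qed.

(** The coproduct of the Casimir element is its two obvious copies plus
    twice this mixed term. *)
Definition Omega : 'M[U]_d := \matrix_(a, b) e b a.

(** Commutation with [Omega] is a derivation on the matrices, so it suffices to
    check it on generators. *)
Lemma OmegaC u : Omega *m shift u = shift u *m Omega.
Proof.
elim/ugl_ind: u => [|p q|u v IHu IHv|c u IHu|u v IHu IHv].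
- by rewrite shift1 mulmx1 mul1mx.
- apply/matrixP => a b; rewrite !mxE.
  under eq_bigr do
    rewrite shift_genij mxE mulrDr mulr_natr mulrnAr -mulnb mulrnA mulrnAC.
  under [RHS]eq_bigr do
    rewrite shift_genij mxE mulrDl mulr_natl mulrnAl -mulnb mulrnA.
  rewrite !big_split /= (sum_mulrb (fun i => e i a * e p q)).
  rewrite (sum_mulrb (fun i => e i a *+ (b == q))).
  rewrite (sum_mulrb_sym (fun i => e p q * e b i)).
  rewrite (sum_mulrb (fun i => e b i *+ (a == p))).
  have /eqP := @ugl_genP K d b a p q.
  rewrite subr_eq => /eqP->; rewrite !scaler_nat (eq_sym a).
  by rewrite addrAC subrK addrC.
- have -> : shift (u + v) = shift u + shift v by exact: raddfD.
  by rewrite mulmxDr mulmxDl IHu IHv.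
- have shiftZ : shift (c *: u) = c%:A%:M *m shift u.
    by rewrite -shift_cst -shiftM mulr_algl.
  rewrite shiftZ -mulmxA -IHu !mulmxA; congr (_ *m _).
  apply/matrixP => a b; rewrite mul_scalar_mx !mxE.
  under eq_bigr do rewrite [c%:A%:M _ _]mxE mulrnAr.
  by rewrite (sum_mulrb (fun i => Omega a i * c%:A)) mxE comm_cst.
- by rewrite !shiftM mulmxA IHu -mulmxA IHv mulmxA.
Qed.

(** * Iterated quasi-derivatives as polarized symbols *)

(** The first entry of the list acts first, which lets inductions generalize
    the argument. *)
Fixpoint qds (v : seq ('I_d * 'I_d)) : {linear U -> U} :=
  if v is x :: v' then qds v' \o qd x else idfun.

Definition order_lt n u := forall v, size v = n -> qds v u = 0.

Lemma qds_cat v w u : qds (v ++ w) u = qds w (qds v u).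
Proof. by elim: v u => //= x v IHv u; rewrite IHv. Qed.

Lemma qds_qdC v x u : qds v (qd x u) = qd x (qds v u).
Proof. by elim: v u => //= y v IHv u; rewrite -IHv qdC. Qed.

Lemma qds_perm v w u : perm_eq v w -> qds v u = qds w u.
Proof.
move: v w; apply: (catCA_perm_subst (F := fun v => qds v u)) => v1 v2 v3.
suff C l1 l2 u' : qds l1 (qds l2 u') = qds l2 (qds l1 u').
  by rewrite !qds_cat (C v2 v1).
by elim: l1 u' => //= x l1 IHl u'; rewrite -qds_qdC IHl.
Qed.

(** Equivariance of symbols: differentiating a commutator with a generator
    conjugates each direction in turn. *)
Lemma qds_ad v p q u : qds v (ad (e p q) u) =
  ad (e p q) (qds v u) +
  delsum (fun x l => qds ((q, x.2) :: l) u *+ (x.1 == p)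
                     - qds ((x.1, p) :: l) u *+ (x.2 == q)) v.
Proof.
elim: v u => [|x v IHv] u; first by rewrite /= addr0.
rewrite [LHS]/= qd_ad linearD IHv /= -addrA; congr (_ + _).
rewrite addrC; congr (_ + _); last first.
  by apply: eq_delsum => y l _ /=; rewrite !(qdC x).
by rewrite linearB /= !raddfMn.
Qed.

(** Multiplicativity of symbols, for a factor of degree one.  The quadratic
    term of the Leibniz rule differentiates [u] too often to contribute. *)
Lemma qds_genM n v p q u : order_lt n.+1 u -> size v = n.+1 ->
  qds v (e p q * u) =
  delsum (fun x l => qds l u *+ ((x.1 == p) && (x.2 == q))) v.
Proof.
elim: n v u => [|n IHn] [|x v] // u u0 [szv] /=; rewrite qd_genM !linearD /=.
all: rewrite !raddfMn /=.
  case: v szv u0 => // _ u0.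
  have qd0 y : qd y u = 0 by apply: (u0 [:: y]).
  by rewrite !qd0 mulr0 mul0rn !addr0.
rewrite IHn //; last by move=> w szw; apply: (u0 (x :: w)); rewrite /= szw.
have -> : qds v (qd (q, x.2) u) = 0.
  by apply: (u0 (_ :: v)); rewrite /= szv.
by rewrite mul0rn addr0.
Qed.

(** Left and right multiplication agree on symbols, since a commutator with a
    generator does not raise the order. *)
Lemma qds_Mgen n v p q u : order_lt n.+1 u -> size v = n.+1 ->
  qds v (u * e p q) =
  delsum (fun x l => qds l u *+ ((x.1 == p) && (x.2 == q))) v.
Proof.
move=> u0 szv; rewrite -(qds_genM _ _ u0 szv).
apply/eqP; rewrite -subr_eq0 -opprB oppr_eq0 -linearB -/(ad _ _) qds_ad.
rewrite u0 // raddf0 add0r delsum0 // => x l /perm_size; rewrite szv => -[szl].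
by rewrite !u0 /= ?szl // !mul0rn subrr.
Qed.

(** The filtration of U by the number of generators.  Scalars are exactly its
    zeroth step, which is not immediate for [order_lt 1]. *)
Inductive gen_degree : nat -> U -> Prop :=
| gen_degree_cst c : gen_degree 0 c%:A
| gen_degreeD n u v : gen_degree n u -> gen_degree n v -> gen_degree n (u + v)
| gen_degree_genM n p q u : gen_degree n u -> gen_degree n.+1 (e p q * u)
| gen_degreeS n u : gen_degree n u -> gen_degree n.+1 u.

Lemma gen_degree_le m n u : (m <= n)%N -> gen_degree m u -> gen_degree n u.
Proof.
move=> /subnK <- um; elim: (n - m)%N => // k; exact: gen_degreeS.
Qed.

Lemma gen_degree0 n : gen_degree n 0.
Proof.
by apply: (@gen_degree_le 0) => //; rewrite -(scale0r 1); apply: gen_degree_cst.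
Qed.

Lemma gen_degreeZ n c u : gen_degree n u -> gen_degree n (c *: u).
Proof.
elim=> {n u} [c'|n u v _ IHu _ IHv|n p q u _ IHu|n u _ IHu].
- by rewrite scalerA; apply: gen_degree_cst.
- by rewrite scalerDr; apply: gen_degreeD.
- by rewrite scalerAr; apply: gen_degree_genM.
- exact: gen_degreeS.
Qed.

Lemma gen_degreeMn n k u : gen_degree n u -> gen_degree n (u *+ k).
Proof. by rewrite -scaler_nat; apply: gen_degreeZ. Qed.

Lemma gen_degreeB n u v :
  gen_degree n u -> gen_degree n v -> gen_degree n (u - v).
Proof.
by move=> hu hv; rewrite -scaleN1r; apply/gen_degreeD/gen_degreeZ.
Qed.

Lemma gen_degree_sum n (I : finType) (F : I -> U) :
  (forall i, gen_degree n (F i)) -> gen_degree n (\sum_i F i).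
Proof.
move=> hF; elim/big_ind: _ => // [|u v]; first exact: gen_degree0.
exact: gen_degreeD.
Qed.

Lemma gen_degreeM m n u v :
  gen_degree m u -> gen_degree n v -> gen_degree (m + n) (u * v).
Proof.
move=> hu hv; elim: hu => {m u} [c|m u u' _ IHu _ IHu'|m p q u _ IHu|m u _ IHu].
- by rewrite mulr_algl; apply: gen_degreeZ.
- by rewrite mulrDl; apply: gen_degreeD.
- by rewrite -mulrA; apply: gen_degree_genM.
- exact: gen_degreeS.
Qed.

Lemma gen_degree_gen p q : gen_degree 1 (e p q).
Proof.
rewrite -(mulr1 (e p q)) -(scale1r 1); apply: gen_degree_genM.
exact: gen_degree_cst.
Qed.

Lemma gen_degree_exists u : exists n, gen_degree n u.
Proof.
elim/ugl_ind: u => [|p q|u v [m hu] [n hv]|c u [n hu]|u v [m hu] [n hv]].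
- by exists 0%N; rewrite -(scale1r 1); apply: gen_degree_cst.
- by exists 1%N; apply: gen_degree_gen.
- exists (m + n)%N; apply: gen_degreeD.
    exact: gen_degree_le (leq_addr _ _) hu.
  exact: gen_degree_le (leq_addl _ _) hv.
- by exists n; apply: gen_degreeZ.
- by exists (m + n)%N; apply: gen_degreeM.
Qed.

Lemma qd_cst x (c : K) : qd x c%:A = 0.
Proof. by rewrite linearZ /= /qd (pqd1 hD) scaler0. Qed.

Lemma gen_degree_qd n x u : gen_degree n u ->
  gen_degree n.-1 (qd x u) /\ (n = 0%N -> qd x u = 0).
Proof.
move=> hu; elim: hu x => {n u}
  [c|n u v _ IHu _ IHv|n p q u hu IHu|n u _ IHu] x.
- by rewrite qd_cst; split=> //; apply: gen_degree0.
- have [[hu u0] [hv v0]] := (IHu x, IHv x).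
  rewrite linearD /=; split=> [|n0]; first exact: gen_degreeD.
  by rewrite u0 ?v0 ?addr0.
- split=> //=; rewrite qd_genM; apply: gen_degreeD; first apply: gen_degreeD.
  + exact: gen_degreeMn.
  + case: n {hu} IHu => [|n] IHu; last exact/gen_degree_genM/(IHu x).1.
    by rewrite (IHu x).2 // mulr0; apply: gen_degree0.
  + by apply/gen_degreeMn/(gen_degree_le (leq_pred n))/(IHu _).1.
- by split=> //; apply: gen_degree_le (leq_pred n) (IHu x).1.
Qed.

Lemma gen_degree_order n u : gen_degree n u -> order_lt n.+1 u.
Proof.
elim: n u => [|n IHn] u hu [|x v] //= [szv].
  by case: v szv => // _; apply: (gen_degree_qd x hu).2.
by apply: IHn => //; apply: (gen_degree_qd x hu).1.
Qed.

(** On symbols this is the Euler vector field, which multiplies a homogeneous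
    polynomial by its degree. *)
Definition euler (u : U) := \sum_p \sum_q e p q * qd (p, q) u.

(** Quasi-derivations lower the degree, and a commutator of two generators is
    linear in the generators, so all corrections to the Euler relation have
    lower degree. *)
Lemma gen_degree_euler n u : gen_degree n u ->
  gen_degree n.-1 (euler u - u *+ n) /\ (n = 0%N -> euler u = 0).
Proof.
have euler0 v : (forall x, qd x v = 0) -> euler v = 0.
  by move=> v0; apply: big1 => p _; apply: big1 => q _; rewrite v0 mulr0.
elim=> {n u} [c|n u v hu IHu hv IHv|n p q u hu [IHu IHu0]|n u hu [IHu IHu0]].
- rewrite euler0; last by move=> x; apply: qd_cst.
  by rewrite subr0; split=> //; apply: gen_degree0.
- have -> : euler (u + v) = euler u + euler v.
    rewrite -big_split; apply: eq_bigr => p _; rewrite -big_split.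
    by apply: eq_bigr => q _; rewrite linearD mulrDr.
  rewrite mulrnDl opprD addrACA.
  split=> [|n0]; first exact: gen_degreeD IHu.1 IHv.1.
  by rewrite IHu.2 // IHv.2 // addr0.
- split=> //=.
  have -> : euler (e p q * u) - e p q * u *+ n.+1 =
      e p q * (euler u - u *+ n)
      + (\sum_a \sum_b ad (e a b) (e p q) * qd (a, b) u
         + \sum_b e p b * qd (q, b) u).
    rewrite /euler; under eq_bigr => a _ do under eq_bigr => b _ do
      rewrite qd_genM !mulrDr mulrA -[e a b * e p q](subrK (e p q * e a b))
        -/(ad _ _) [(ad _ _ + _) * _]mulrDl -(mulrA (e p q)) -mulnb mulrnA
        !mulrnAr.
    under eq_bigr => a _ do rewrite !big_split /=
      (sum_mulrb (fun b => e a b * u *+ (a == p))) -mulr_sumr sumrMnl.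
    rewrite !big_split /= (sum_mulrb (fun a => e a q * u)).
    rewrite (sum_mulrb (fun a => \sum_b e a b * qd (q, b) u)) -mulr_sumr.
    rewrite mulrSr opprD mulrBr mulrnAr !addrA.
    rewrite -!addrA addrC !addrA subrK [LHS]addrAC; congr (_ + _).
    by rewrite -addrA addrC.
  have qd_deg x : if n is m.+1 then gen_degree m (qd x u) else qd x u = 0.
    have [] := gen_degree_qd x hu; case: n {IHu IHu0 hu} => //= _; exact.
  apply: gen_degreeD; last apply: gen_degreeD.
  + case: n IHu IHu0 {hu qd_deg} => [|n] IHu IHu0; last exact: gen_degree_genM.
    by rewrite IHu0 // subrr mulr0; apply: gen_degree0.
  + apply: gen_degree_sum => a; apply: gen_degree_sum => b.
    case: n qd_deg {IHu IHu0 hu} => [|n] qd_deg.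
      by rewrite qd_deg mulr0; apply: gen_degree0.
    rewrite /ad ugl_genP !scaler_nat mulrBl !mulrnAl.
    by apply: gen_degreeB; apply/gen_degreeMn/gen_degree_genM/qd_deg.
  + apply: gen_degree_sum => b.
    case: n qd_deg {IHu IHu0 hu} => [|n] qd_deg; last exact: gen_degree_genM.
    by rewrite qd_deg mulr0; apply: gen_degree0.
- split=> //=; rewrite mulrSr opprD addrA; apply: gen_degreeB => //.
  exact: gen_degree_le (leq_pred n) IHu.
Qed.

Hypothesis char0 : forall n, n.+1%:R != 0 :> K.

(** If all first quasi-derivatives of [u] vanish then so does [euler u], and the
    Euler relation lowers the degree of [u] until it is zero. *)
Lemma order_lt1_cst u : order_lt 1 u -> exists c, u = c%:A.
Proof.
move=> u1; have [n] := gen_degree_exists u.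
have euler_u : euler u = 0.
  apply: big1 => p _; apply: big1 => q _.
  by rewrite (u1 [:: (p, q)]) ?mulr0.
elim: n => [|n IHn] hu.
  move: hu; move En : 0%N => n hu; elim: hu En => {u u1 euler_u n} //.
    by move=> c _; exists c.
  move=> n u v _ IHu _ IHv n0; have [[c ->] [c' ->]] := (IHu n0, IHv n0).
  by exists (c + c'); rewrite scalerDl.
apply: IHn; have [] := gen_degree_euler hu; rewrite euler_u sub0r /= => h _.
have -> : u = - (n.+1%:R)^-1 *: (- (u *+ n.+1)).
  by rewrite scaleNr scalerN opprK -scaler_nat scalerA mulVf ?char0 // scale1r.
exact: gen_degreeZ.
Qed.

(** * Contractions with numerical matrices *)

Definition contract (eta : 'M[K]_d) (W : 'M[U]_d) : U :=
  \sum_a \sum_b eta a b *: W a b.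

Lemma contractD eta eta' W :
  contract (eta + eta') W = contract eta W + contract eta' W.
Proof.
rewrite -big_split; apply: eq_bigr => a _; rewrite -big_split.
by apply: eq_bigr => b _; rewrite mxE scalerDl.
Qed.

Lemma contractZ t eta W : contract (t *: eta) W = t *: contract eta W.
Proof.
rewrite scaler_sumr; apply: eq_bigr => a _; rewrite scaler_sumr.
by apply: eq_bigr => b _; rewrite mxE scalerA.
Qed.

Lemma contractB eta eta' W :
  contract (eta - eta') W = contract eta W - contract eta' W.
Proof. by rewrite -scaleN1r contractD contractZ scaleN1r. Qed.

Lemma contract0 eta : contract eta 0 = 0.
Proof. by apply: big1 => a _; apply: big1 => b _; rewrite mxE scaler0. Qed.

Lemma contract_delta a b W : contract (delta_mx a b) W = W a b.
Proof.
rewrite /contract (bigD1 a) //= (bigD1 b) //= mxE !eqxx scale1r.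
rewrite !big1 ?addr0 // => [i /negPf ia|j /negPf jb].
  by rewrite big1 // => j _; rewrite mxE ia scale0r.
by rewrite mxE eqxx jb scale0r.
Qed.

Lemma linear_contract (h : {linear U -> U}) eta W :
  h (contract eta W) = contract eta (\matrix_(a, b) h (W a b)).
Proof.
rewrite linear_sum; apply: eq_bigr => a _; rewrite linear_sum.
by apply: eq_bigr => b _; rewrite linearZ mxE.
Qed.

(** * Transposition *)

Variable theta : {linear U -> U}.
Hypothesis theta1 : theta 1 = 1.
Hypothesis thetaM : forall u v, theta (u * v) = theta v * theta u.
Hypothesis theta_gen : forall p q, theta (e p q) = e q p.

Lemma theta_cst (c : K) : theta c%:A = c%:A.
Proof. by rewrite linearZ /= theta1. Qed.

Lemma thetaK u : theta (theta u) = u.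
Proof.
elim/ugl_ind: u => [|p q|u v IHu IHv|c u IHu|u v IHu IHv].
- by rewrite !theta1.
- by rewrite !theta_gen.
- by rewrite !linearD /= IHu IHv.
- by rewrite !linearZ /= IHu.
- by rewrite !thetaM IHu IHv.
Qed.

Lemma shift_theta u a b : shift (theta u) a b = theta (shift u b a).
Proof.
elim/ugl_ind: u a b => [|p q|u v IHu IHv|c u IHu|u v IHu IHv] a b.
- by rewrite theta1 !shift1ij raddfMn /= theta1 eq_sym.
- rewrite theta_gen !shift_genij linearD /= !raddfMn /= theta_gen theta1.
  by rewrite (eq_sym a b) andbC.
- by rewrite linearD !shiftDij linearD /= IHu IHv.
- by rewrite linearZ !shiftZij linearZ /= IHu.
- rewrite thetaM !shiftMij linear_sum; apply: eq_bigr => k _.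
  by rewrite thetaM IHu IHv.
Qed.

Lemma qd_theta a b u : qd (a, b) (theta u) = theta (qd (b, a) u).
Proof. by rewrite !qdE shift_theta linearB (raddfMn theta) /= (eq_sym a). Qed.

Definition diag_ix (i : 'I_d) := (i, i).

Lemma qds_diag_theta l u :
  qds (map diag_ix l) (theta u) = theta (qds (map diag_ix l) u).
Proof. by elim: l u => //= i l IHl u; rewrite qd_theta IHl. Qed.

(** * Vanishing of equivariant antisymmetric families *)

Section Vanishing.
Variables (c : 'M[K]_d -> U) (w : 'M[K]_d -> 'M[U]_d).
Hypothesis c_grad : forall xi eta, exists P : {poly U},
  (forall t : K, P.[t%:A] = c (xi + t *: eta)) /\
  (forall t : K, P^`().[t%:A] = contract eta (w (xi + t *: eta))).
Hypothesis c_ad : forall xi p q, ad (e p q) (c xi) =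
  contract (xi *m delta_mx q p - delta_mx q p *m xi) (w xi).
Hypothesis w_comm : forall xi, Omega *m w xi = w xi *m Omega.
Hypothesis c_theta : forall xi, theta (c xi) = - c xi^T.

Lemma qds_grad0 v : (forall xi, qds v (c xi) = 0) ->
  forall xi a b, qds v (w xi a b) = 0.
Proof.
move=> c0 xi a b; have [P [Pc Pw]] := c_grad xi (delta_mx a b).
have := family_deriv0 char0 (h := qds v) (P := P) _ 0.
rewrite Pw scale0r addr0 contract_delta; apply => t.
by rewrite Pc.
Qed.

(** The symbol of [w xi] at a matrix x commutes with x: at a diagonal x its
    (a, b) entry is killed by x_a - x_b. *)
Lemma offdiag_grad0 n : (forall xi, order_lt n.+1 (c xi)) ->
  forall xi a b, a != b -> forall l, size l = n ->
  qds (map diag_ix l) (w xi a b) = 0.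
Proof.
move=> cn xi a b ab.
have wn a' b' : order_lt n.+1 (w xi a' b').
  by move=> v szv; apply: qds_grad0 => xi'; apply: cn.
apply: (delsum_inj char0 ab) => l szl.
have szl' : size (map diag_ix l) = n.+1 by rewrite size_map.
have /matrixP/(_ a b) := w_comm xi.
rewrite !mxE => /(congr1 (qds (map diag_ix l))).
rewrite !linear_sum /=.
under eq_bigr do rewrite mxE (qds_genM _ _ (wn _ _) szl') delsum_map.
under [RHS]eq_bigr do rewrite mxE (qds_Mgen _ _ (wn _ _) szl') delsum_map.
rewrite -!delsum_sum => /eqP; rewrite -subr_eq0 -delsumB => /eqP.
rewrite -[RHS]/0 => <-; apply: eq_delsum => i l' _ /=; congr (_ - _).
  under [RHS]eq_bigr do rewrite -mulnb mulrnA.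
  rewrite sumrMnl (sum_mulrb_sym (fun k => qds (map diag_ix l') (w xi k b))).
  by case: eqP => // ->.
under [RHS]eq_bigr do rewrite andbC -mulnb mulrnA.
rewrite sumrMnl (sum_mulrb_sym (fun k => qds (map diag_ix l') (w xi a k))).
by case: eqP => // ->.
Qed.

(** At diagonal x the symbol of [c xi] does not see the off-diagonal part of
    [xi]; once [xi] is diagonal, transposition changes the sign of that
    scalar. *)
Lemma diag_family0 n : (forall xi, order_lt n.+1 (c xi)) ->
  forall xi l, size l = n -> qds (map diag_ix l) (c xi) = 0.
Proof.
move=> cn xi l szl.
(* Move from the diagonal part of xi to xi along a line. *)
pose dg : 'M[K]_d := \matrix_(a, b) (xi a b *+ (a == b)).
pose off := xi - dg.
have [P [Pc Pw]] := c_grad dg off.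
have -> : xi = dg + 1 *: off by rewrite scale1r addrC subrK.
have Pconst := family_const char0 (h := qds (map diag_ix l)) (P := P) _ 1 0.
rewrite -Pc Pconst => [|t]; last first.
  rewrite Pw linear_contract; apply: big1 => a _; apply: big1 => b _.
  rewrite !mxE; have [->|ab] := eqVneq a b; first by rewrite subrr scale0r.
  by rewrite (offdiag_grad0 cn) ?scaler0.
rewrite Pc scale0r addr0.
have dgT : dg^T = dg.
  by apply/matrixP => a b; rewrite !mxE eq_sym; case: eqP => // ->.
set u := qds _ _.
have u1 : order_lt 1 u.
  case=> [//|x [|//]] _; rewrite -qds_cat; apply: cn.
  by rewrite size_cat size_map szl addn1.
have [k uk] := order_lt1_cst u1.
have : theta u = - u by rewrite -qds_diag_theta c_theta dgT linearN.
rewrite uk theta_cst => /eqP; rewrite -subr_eq0 opprK -mulr2n => /eqP.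
exact: (mulrSn_eq0 char0).
Qed.

(** Vanishing of the symbol spreads from diagonal directions to all directions,
    by induction on the number of directions not known to be diagonal.  An
    off-diagonal direction (q, p) is the bracket of a diagonal one with an
    elementary matrix, so equivariance expresses derivatives along it through
    derivatives with fewer such directions. *)
Lemma family_order n : (forall xi, order_lt n.+1 (c xi)) ->
  forall xi, order_lt n (c xi).
Proof.
move=> cn.
suff gen m o l xi : size o = m -> (m + size l)%N = n ->
    qds (o ++ map diag_ix l) (c xi) = 0.
  by move=> xi v szv; rewrite -(cats0 v); apply: (gen n v [::]); rewrite ?addn0.
elim: m o l xi => [|m IHm] [|[q p] o] // l xi => [_|[szo] szl].
  exact: (diag_family0 cn).
have [pq|pq] := eqVneq p q.
  rewrite -pq (@qds_perm _ (o ++ map diag_ix (p :: l))); last first.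
    by rewrite /= perm_sym -cat1s perm_catCA.
  by apply: IHm; rewrite // addnS -szl.
(* The relation comes from a list with a diagonal entry in place of (q, p). *)
pose tau l' := qds ((q, p) :: o ++ map diag_ix l') (c xi).
apply: (@delsum_inj _ _ char0 _ p q tau (size l)) => // l' szl'.
have szV : (m + size l')%N = n by rewrite szl' addnS -szl.
have := qds_ad (o ++ map diag_ix l') p q (c xi).
have -> : qds (o ++ map diag_ix l') (ad (e p q) (c xi)) = 0.
  rewrite c_ad linear_contract; apply: big1 => a _; apply: big1 => b _.
  by rewrite [X in _ *: X]mxE qds_grad0 ?scaler0 // => xi'; apply: IHm.
have -> : qds (o ++ map diag_ix l') (c xi) = 0 by apply: IHm.
rewrite raddf0 add0r delsum_cat [X in X + _]delsum0 ?add0r; last first.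
  move=> x v /perm_size; rewrite szo /= => -[szv].
  have IHx y : qds (y :: v ++ map diag_ix l') (c xi) = 0.
    by apply: (IHm (y :: v)); rewrite /= ?szv.
  have := IHx (q, x.2); have := IHx (x.1, p); rewrite /= => -> ->.
  by rewrite !mul0rn subrr.
rewrite delsum_map => ->; apply: eq_delsum => i v _ /=.
rewrite /tau /=; congr (_ - _).
  by case: eqP => // ->.
by case: eqP => // ->.
Qed.

(** Each round of [family_order] lowers the order by one, down to order zero,
    where only the zero element remains. *)
Lemma family0 n : (forall xi, order_lt n (c xi)) -> forall xi, c xi = 0.
Proof.
elim: n => [|n IHn] cn; last exact/IHn/family_order.
by move=> xi; apply: (cn xi [::]).
Qed.
End Vanishing.

Local Notation dq := (directional_quasi_derivation D).

(** * Commutators of iterated directional quasi-derivatives *)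

Definition qd_mx (u : U) : 'M[U]_d := \matrix_(a, b) qd (a, b) u.

Lemma dqE xi u : dq xi u = contract xi (qd_mx u).
Proof. by apply: eq_bigr => a _; apply: eq_bigr => b _; rewrite mxE. Qed.

Lemma dq_is_linear xi : linear (dq xi).
Proof.
move=> k u v; rewrite !dqE scaler_sumr -big_split; apply: eq_bigr => a _.
rewrite scaler_sumr -big_split; apply: eq_bigr => b _.
by rewrite !mxE linearP scalerDr !scalerA mulrC.
Qed.

HB.instance Definition _ xi :=
  GRing.isLinear.Build K U U _ (dq xi) (dq_is_linear xi).

Lemma dqD xi eta t u : dq (xi + t *: eta) u = dq xi u + t *: dq eta u.
Proof. by rewrite !dqE contractD contractZ. Qed.

Lemma qd_dq x xi u : qd x (dq xi u) = dq xi (qd x u).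
Proof.
rewrite !dqE linear_contract; apply: eq_bigr => a _; apply: eq_bigr => b _.
by rewrite !mxE qdC.
Qed.

Lemma qd_mx_dq xi u : qd_mx (dq xi u) = \matrix_(a, b) dq xi (qd_mx u a b).
Proof. by apply/matrixP => a b; rewrite !mxE qd_dq. Qed.

Lemma dqC xi eta u : dq xi (dq eta u) = dq eta (dq xi u).
Proof. by rewrite [in LHS]dqE qd_mx_dq -linear_contract -dqE. Qed.

Lemma theta_dq xi u : theta (dq xi u) = dq xi^T (theta u).
Proof.
rewrite !dqE linear_contract /contract exchange_big.
by apply: eq_bigr => a _; apply: eq_bigr => b _; rewrite !mxE qd_theta.
Qed.

Lemma gen_degree_iter_dq n k xi u :
  gen_degree n u -> gen_degree n (iter k (dq xi) u).
Proof.
move=> hu; elim: k => //= k IHk; rewrite dqE.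
apply: gen_degree_sum => a; apply: gen_degree_sum => b; apply: gen_degreeZ.
rewrite mxE; apply: gen_degree_le (leq_pred n) _.
by have [] := gen_degree_qd (a, b) IHk.
Qed.

Lemma contract_bracket p q xi W :
  contract (xi *m delta_mx q p - delta_mx q p *m xi) W =
  \sum_a xi a q *: W a p - \sum_b xi p b *: W q b.
Proof.
rewrite contractB; congr (_ - _).
  apply: eq_bigr => a _; rewrite (bigD1 p) //= mxE (bigD1 q) //= mxE !eqxx.
  rewrite mulr1 !big1 ?addr0 // => [b /negPf bp|i /negPf iq].
    by rewrite mxE big1 ?scale0r // => i _; rewrite mxE bp andbF mulr0.
  by rewrite mxE iq mulr0.
rewrite /contract (bigD1 q) //= [X in _ + X]big1 ?addr0 => [|a /negPf aq].
  apply: eq_bigr => b _; rewrite mxE (bigD1 p) //= mxE !eqxx mul1r.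
  by rewrite big1 ?addr0 // => i /negPf ip; rewrite mxE ip andbF mul0r.
apply: big1 => b _; rewrite mxE big1 ?scale0r // => i _.
by rewrite mxE aq mul0r.
Qed.

(** The correction term is the quasi-derivative along the bracket of [xi] with
    an elementary matrix. *)
Lemma ad_dq p q xi u : ad (e p q) (dq xi u) =
  dq xi (ad (e p q) u)
  + contract (xi *m delta_mx q p - delta_mx q p *m xi) (qd_mx u).
Proof.
have -> : dq xi (ad (e p q) u) = ad (e p q) (dq xi u)
    + (\sum_b xi p b *: qd (q, b) u - \sum_a xi a q *: qd (a, p) u).
  rewrite !dqE linear_contract /contract.
  under eq_bigr => a _ do under eq_bigr => b _ do
    rewrite mxE qd_ad /= scalerDr [X in _ + X]scalerBr -!scalerMnr.
  under eq_bigr => a _ do rewrite !big_split /= sumrN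
    (sum_mulrb (fun b => xi a b *: qd (a, p) u)) sumrMnl.
  rewrite !big_split /= sumrN.
  rewrite (sum_mulrb (fun a => \sum_b xi a b *: qd (q, b) u)).
  congr (_ + _); apply: eq_bigr => a _; apply: eq_bigr => b _.
  by rewrite !mxE.
rewrite contract_bracket -addrA -[X in _ + (X + _)]opprB.
have -> : \sum_a xi a q *: qd (a, p) u = \sum_a xi a q *: qd_mx u a p.
  by apply: eq_bigr => a _; rewrite mxE.
have -> : \sum_b xi p b *: qd (q, b) u = \sum_b xi p b *: qd_mx u q b.
  by apply: eq_bigr => b _; rewrite mxE.
by rewrite addNr addr0.
Qed.

(** A central element is annihilated by the adjoint action, so only the
    correction terms of [ad_dq] remain; they commute with [dq xi]. *)
Lemma ad_iter_dq f (f_central : ugl_center f) k p q xi :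
  ad (e p q) (iter k (dq xi) f) =
  contract (xi *m delta_mx q p - delta_mx q p *m xi)
           (qd_mx (iter k.-1 (dq xi) f)) *+ k.
Proof.
set M := _ - _; elim: k => [|k IHk].
  have := f_central (e p q); rewrite /GRing.comm mulr0n /ad /= => ->.
  exact: subrr.
rewrite [iter k.+1 _ _]/= ad_dq -/M IHk raddfMn mulrSr; congr (_ + _).
case: k {IHk} => //= k; rewrite linear_contract qd_mx_dq; congr (_ *+ _).
Qed.

Lemma adDl x y u : ad (x + y) u = ad x u + ad y u.
Proof. by rewrite /ad mulrDl mulrDr opprD addrACA. Qed.
Lemma adZl k x u : ad (k *: x) u = k *: ad x u.
Proof. by rewrite /ad -scalerAl -scalerAr scalerBr. Qed.
Lemma adMnl n x u : ad (x *+ n) u = ad x u *+ n.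
Proof. by rewrite -!scaler_nat adZl. Qed.

Lemma adC x y : ad x y = - ad y x.
Proof. by rewrite /ad opprB. Qed.

Lemma ad_ad x u v : ad x (ad u v) = ad (ad x u) v + ad u (ad x v).
Proof.
rewrite /ad !mulrBr !mulrBl !mulrA !opprB.
rewrite [RHS]addrACA !addrA !subrK -!addrA; congr (_ + _).
by rewrite addrCA [RHS]addrCA; congr (_ + _); rewrite addrC.
Qed.

Lemma ad_contractl eta W u : ad (contract eta W) u =
  contract eta (\matrix_(a, b) ad (W a b) u).
Proof.
rewrite adC linear_contract -[LHS]scaleN1r scaler_sumr.
apply: eq_bigr => a _; rewrite scaler_sumr; apply: eq_bigr => b _.
by rewrite !mxE scalerA mulrC -scalerA scaleN1r -adC.
Qed.

Section Commutators.
Variables f g : U.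
Hypotheses (f_central : ugl_center f) (g_central : ugl_center g).

Definition comm_family m n xi := ad (iter m (dq xi) f) (iter n (dq xi) g).

(** The gradient in [xi] of [comm_family m n], by
    [comm_family_grad]. *)
Definition comm_gradient m n xi : 'M[U]_d := \matrix_(a, b)
  (ad (qd (a, b) (iter m.-1 (dq xi) f)) (iter n (dq xi) g) *+ m
   + ad (iter m (dq xi) f) (qd (a, b) (iter n.-1 (dq xi) g)) *+ n).

Lemma contract_comm_gradient eta m n xi : contract eta (comm_gradient m n xi) =
  ad (dq eta (iter m.-1 (dq xi) f)) (iter n (dq xi) g) *+ m
  + ad (iter m (dq xi) f) (dq eta (iter n.-1 (dq xi) g)) *+ n.
Proof.
rewrite !dqE ad_contractl linear_contract -!sumrMnl -big_split.
apply: eq_bigr => a _; rewrite -!sumrMnl -big_split; apply: eq_bigr => b _.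
by rewrite !mxE scalerDr !scalerMnr.
Qed.

(** The element [iter k (dq (xi + t *: eta)) u] as a polynomial in [t]. *)
Definition shift_family xi eta k (u : U) : {poly U} :=
  iter k (fun Q => map_poly (dq xi) Q + map_poly (dq eta) Q * 'X) u%:P.

Lemma horner_shift_family xi eta k u (t : K) :
  (shift_family xi eta k u).[t%:A] = iter k (dq (xi + t *: eta)) u.
Proof.
elim: k => [|k IHk] /=; first by rewrite hornerC.
rewrite hornerD hornerMX !horner_map_linear IHk dqD; congr (_ + _).
by rewrite mulr_algr.
Qed.

Lemma deriv_shift_family xi eta k u :
  (shift_family xi eta k u)^`() =
  map_poly (dq eta) (shift_family xi eta k.-1 u) *+ k.
Proof.
elim: k => [|k IHk]; first by rewrite derivC mulr0n.
rewrite [shift_family _ _ _ _]/= -/(shift_family xi eta k u).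
rewrite derivD derivM derivX mulr1 !deriv_map_linear IHk mulrSr addrA.
congr (_ + _); case: k {IHk} => [|k].
  by rewrite !mulr0n /= !raddf0 mul0r addr0.
rewrite !raddfMn mulrnAl -mulrnDl; congr (_ *+ _).
rewrite [shift_family _ _ k.+1 _]/= -/(shift_family xi eta k u) raddfD /=.
congr (_ + _).
  by apply/polyP => i; rewrite !coef_map_id0 ?raddf0 // dqC.
apply/polyP => i; rewrite coef_map_id0 ?raddf0 // !coefMX.
by case: i => [|i]; rewrite ?raddf0 // !coef_map_id0 ?raddf0.
Qed.

Lemma comm_family_grad m n xi eta : exists P : {poly U},
  (forall t : K, P.[t%:A] = comm_family m n (xi + t *: eta)) /\
  (forall t : K, P^`().[t%:A] =
     contract eta (comm_gradient m n (xi + t *: eta))).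
Proof.
pose Pf k := shift_family xi eta k f; pose Pg k := shift_family xi eta k g.
have hornerS (P Q : {poly U}) (t : K) : (P * Q).[t%:A] = P.[t%:A] * Q.[t%:A].
  by rewrite hornerM_comm // /comm_poly comm_cst.
exists (Pf m * Pg n - Pg n * Pf m); split=> t.
  by rewrite hornerD hornerN !hornerS !horner_shift_family.
rewrite contract_comm_gradient derivB !derivM !deriv_shift_family.
rewrite !(hornerD, hornerN, hornerS, hornerMn, horner_map_linear).
rewrite !horner_shift_family /ad !mulrnBl !mulrnAl !mulrnAr.
by rewrite opprD [X in _ + X]addrC addrACA.
Qed.

Lemma ad_comm_family m n xi p q : ad (e p q) (comm_family m n xi) =
  contract (xi *m delta_mx q p - delta_mx q p *m xi) (comm_gradient m n xi).
Proof.
rewrite /comm_family ad_ad !ad_iter_dq // contract_comm_gradient !dqE.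
by rewrite adMnl [X in _ + X]raddfMn.
Qed.

Lemma mulmx_scalarE (W : 'M[U]_d) u a b : (W * u%:M) a b = W a b * u.
Proof.
rewrite -mulmxE mxE; under eq_bigr do rewrite [u%:M _ _]mxE mulrnAr.
exact: (sum_mulrb (fun k => W a k * u)).
Qed.

Lemma scalar_mulmxE (W : 'M[U]_d) u a b : (u%:M * W) a b = u * W a b.
Proof. by rewrite -mulmxE mul_scalar_mx mxE. Qed.

(** By the three vanishing hypotheses the gradient can be written with [shift]
    in place of bare quasi-derivatives, and the images under [shift] of the
    previous iterates commute; then [gradient_comm] applies. *)
Lemma comm_gradient_Omega m n xi :
  comm_family m n.+1 xi = 0 -> comm_family m.+1 n xi = 0 ->
  comm_family m n xi = 0 ->
  Omega *m comm_gradient m.+1 n.+1 xi = comm_gradient m.+1 n.+1 xi *m Omega.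
Proof.
rewrite /comm_family; set fm := iter m _ f; set gn := iter n _ g => c1 c2 c0.
have -> : comm_gradient m.+1 n.+1 xi =
    (shift fm * (dq xi gn)%:M - (dq xi gn)%:M * shift fm) *+ m.+1
    + ((dq xi fm)%:M * shift gn - shift gn * (dq xi fm)%:M) *+ n.+1.
  apply/matrixP => a b.
  rewrite [LHS]mxE [RHS]mxE !mulmxnE.
  rewrite [in RHS]mxE [X in _ = (_ + X) *+ _ + _]mxE.
  rewrite [X in _ = _ + X *+ _]mxE [X in _ = _ + (_ + X) *+ _]mxE.
  rewrite !mulmx_scalarE !scalar_mulmxE -!/(ad _ _) !shiftE.
  rewrite adDl adMnl c1 mul0rn addr0 [X in _ = _ + X *+ _]linearD /=.
  by rewrite [X in _ = _ + (_ + X) *+ _]raddfMn /= c2 mul0rn addr0.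
pose X : 'M[U]_d := \matrix_(a, b) (xi b a)%:A.
have OmegaX k u (u_central : ugl_center u) : let v := iter k (dq xi) u in
    Omega * (dq xi v)%:M - (dq xi v)%:M * Omega =
    (X * shift v - shift v * X) *+ k.+1.
  move=> v; apply/matrixP => a b.
  rewrite mulmxnE mxE [X in _ + X]mxE mulmx_scalarE scalar_mulmxE.
  rewrite [Omega _ _]mxE -/(ad _ _) -[dq xi v]/(iter k.+1 (dq xi) u).
  rewrite ad_iter_dq // contract_bracket; congr (_ *+ _).
  rewrite [RHS]mxE [X in _ = _ + X]mxE -!mulmxE !mxE.
  under [X in _ = X - _]eq_bigr do
    rewrite mxE mulr_algl shiftE scalerDr -scalerMnr.
  under [X in _ = _ - X]eq_bigr do
    rewrite [X _ _]mxE mulr_algr shiftE scalerDr -scalerMnr.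
  rewrite !big_split /= (sum_mulrb (fun i => xi i a *: v)).
  rewrite (sum_mulrb_sym (fun i => xi b i *: v)) opprD addrACA subrr addr0.
  by congr (_ - _); apply: eq_bigr => i _; rewrite mxE.
apply: (gradient_comm (X := X)).
- exact: OmegaC.
- exact: OmegaC.
- rewrite -!mulmxE -!shiftM; congr shift; apply/eqP; rewrite -subr_eq0.
  exact/eqP.
- exact: OmegaX.
- exact: OmegaX.
Qed.

Hypotheses (theta_f : theta f = f) (theta_g : theta g = g).

Lemma theta_comm_family m n xi :
  theta (comm_family m n xi) = - comm_family m n xi^T.
Proof.
have theta_iter k u : theta (iter k (dq xi) u) = iter k (dq xi^T) (theta u).
  by elim: k => //= k IHk; rewrite theta_dq IHk.
rewrite /comm_family /ad linearB /= !thetaM !theta_iter theta_f theta_g.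
by rewrite opprB.
Qed.

Lemma comm_family_order m n :
  exists k, forall xi, order_lt k (comm_family m n xi).
Proof.
have [[i hf] [j hg]] := (gen_degree_exists f, gen_degree_exists g).
exists (i + j).+1 => xi; apply: gen_degree_order.
have hfm := gen_degree_iter_dq m xi hf; have hgn := gen_degree_iter_dq n xi hg.
by apply: gen_degreeB; [|rewrite addnC]; apply: gen_degreeM.
Qed.

(** Induction on [m + n]; when one exponent is zero, centrality is enough. *)
Lemma comm_family0 m n xi : comm_family m n xi = 0.
Proof.
have [N] := ubnP (m + n)%N; elim: N m n xi => // N IHN m n xi.
case: m => [_|m]; first by rewrite /comm_family /ad f_central subrr.
case: n => [_|n]; first by rewrite /comm_family /ad -g_central subrr.
rewrite addSn addnS !ltnS => ltN.
have [k ck] := comm_family_order m.+1 n.+1.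
apply: (family0 (w := comm_gradient m.+1 n.+1)) ck xi.
- exact: comm_family_grad.
- by move=> xi p q; apply: ad_comm_family.
- move=> xi'; apply: comm_gradient_Omega; apply: IHN.
  + by rewrite addnS.
  + by rewrite addSn.
  + exact: ltnW.
- exact: theta_comm_family.
Qed.

End Commutators.

(** The difference [theta f - f] is central and changes sign under [theta]: it
    is a constant family to which [family0] applies with zero gradient. *)
Lemma theta_center f : ugl_center f -> theta f = f.
Proof.
move=> f_central; apply/eqP; rewrite -subr_eq0; apply/eqP.
have thetaf_central : ugl_center (theta f).
  by move=> u; rewrite /GRing.comm -(thetaK u) -!thetaM f_central.
have [k df] : exists k, gen_degree k (theta f - f).
  exact: gen_degree_exists.
apply: (@family0 (fun _ => theta f - f) (fun _ => 0)) (0 : 'M_d) => //.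
- move=> xi eta; exists (theta f - f)%:P; split=> t; first by rewrite hornerC.
  by rewrite derivC horner0 contract0.
- move=> xi p q; rewrite /ad mulrBr mulrBl -f_central -thetaf_central subrr.
  by rewrite contract0.
- by move=> xi; rewrite mulmx0 mul0mx.
- by move=> xi; rewrite linearB /= thetaK opprB.
by move=> xi; apply: gen_degree_order df.
Qed.

Lemma iter_dq_comm f g m n xi : ugl_center f -> ugl_center g ->
  GRing.comm (iter m (dq xi) f) (iter n (dq xi) g).
Proof.
move=> f_central g_central; apply/eqP; rewrite -subr_eq0 -/(ad _ _).
apply/eqP; apply: comm_family0 => //; exact: theta_center.
Qed.

End QuasiDerivations.

(** The relations of gl_d are preserved by transposing all indices and reversing
    products, so the universal property applies to the converse ring. *)
Lemma ugl_transpose (K : fieldType) (d : nat) :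
  exists theta : {linear ugl K d -> ugl K d},
  [/\ theta 1 = 1, forall u v, theta (u * v) = theta v * theta u
    & forall p q, theta (ugl_gen p q) = ugl_gen q p].
Proof.
pose U := ugl K d.
pose s (c : K) : U^c := (c%:A : U).
have s_zmod : zmod_morphism s by move=> a b; rewrite /s scalerBl.
have s_monoid : monoid_morphism s.
  split=> [|a b]; first exact: scale1r.
  change ((a * b)%:A = b%:A * a%:A :> U).
  by rewrite mulr_algl scalerA mulrC.
pose S : {rmorphism K -> U^c} := HB.pack s
  (GRing.isZmodMorphism.Build K U^c s s_zmod)
  (GRing.isMonoidMorphism.Build K U^c s s_monoid).
have [c i j|i j p q|phi [phi_gen phiZ]] :=
  @ugl_lift K d U^c S (fun i j => ugl_gen j i).
- change (ugl_gen j i * c%:A = c%:A * ugl_gen j i :> U).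
  by rewrite mulr_algr mulr_algl.
- change (ugl_gen q p * ugl_gen j i - ugl_gen j i * ugl_gen q p =
    ugl_gen q i * (p == j)%:R%:A - ugl_gen j p * (i == q)%:R%:A :> U).
  by rewrite ugl_genP !mulr_algr (eq_sym j) (eq_sym q).
have phi_lin : linear (phi : U -> U).
  move=> c u v; rewrite rmorphD phiZ; congr (_ + _).
  by change ((phi u : U) * c%:A = c *: (phi u : U) :> U); rewrite mulr_algr.
pose T : {linear U -> U} := HB.pack (phi : U -> U)
  (GRing.isLinear.Build K U U _ (phi : U -> U) phi_lin).
exists T; split=> [|u v|p q].
- exact: rmorph1 phi.
- exact: rmorphM phi u v.
- exact: phi_gen.
Qed.

Theorem theorem1 (R : realType) (K : fieldType)
    (hK : K = (R : fieldType) \/ K = (R[i] : fieldType))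
    (d : nat) (hd : (1 <= d)%N)
    (D : 'I_d -> 'I_d -> {linear ugl K d -> ugl K d})
    (hD : partial_quasi_derivations D)
    (xi : 'M[K]_d) (f g : ugl K d) (hf : ugl_center f) (hg : ugl_center g)
    (p q : nat) :
  GRing.comm (iter p (directional_quasi_derivation D xi) f)
             (iter q (directional_quasi_derivation D xi) g).
Proof.
have char0 n : n.+1%:R != 0 :> K.
  by case: hK => ->; rewrite Num.Theory.pnatr_eq0.
have [theta [theta1 thetaM theta_gen]] := ugl_transpose K d.
by apply: (iter_dq_comm hD char0 theta1 thetaM theta_gen).
Qed.
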